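(* Let $\mathcal{C}$ be a small poset-enriched category and $F,G:\mathcal{C}\to\mathbf{Pos}$ enriched functors such that $GA$ is a complete poset for every object $A$ of $\mathcal{C}$. Let $\kappa$ be a regular cardinal. Suppose that $(G_1)$ $Gf$ preserves $\kappa$-directed joins for all morphisms $f$ in $\mathcal{C}$; $(F_1)$ for every object $A$ and every $x\in FA$, the subset $(l'_A\downarrow x)_{=}$ is cofinal in $l'_A\downarrow x$; $(F_2)$ $\mathcal{C}$ has and $F$ preserves $\kappa$-wide pullbacks. Then for every lax transformation $\lambda:F\to G$ the colaxification $\overline{\lambda}$ is a strict transformation (i.e. $(F,G,\emptyset)$ satisfies the strictness condition). Furthermore, for every lax transformation $\lambda:F\to G$, every object $A$ of $\mathcal{C}$ and every $x\in FA$, $$\overline{\lambda}_A(x)=\bigvee\left\{Gg(\lambda_C(y))\mid g:C\to A \text{ in } \mathcal{C},\ y\in FC\text{ such that }Fg(y)\le x\right\}.$$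
   Context: $\mathbf{Pos}$ is the category of posets and order-preserving maps, enriched over itself (pointwise order). A lax (resp. colax) transformation $\tau:F\to G$ is a family of order-preserving maps $(\tau_A:FA\to GA)_A$ with $\tau_B\circ Ff\le Gf\circ\tau_A$ (resp. $\tau_B\circ Ff\ge Gf\circ\tau_A$) for all morphisms $f:A\to B$ of $\mathcal{C}$; it is strict if equality holds for all $f$. Transformations are ordered pointwise. For a lax transformation $\lambda$, its colaxification $\overline{\lambda}$ is the least colax transformation $\sigma:F\to G$ with $\lambda\le\sigma$ (it exists since each $GA$ is complete). The triple $(F,G,\emptyset)$ satisfies the strictness condition if $\overline{\lambda}$ is strict for every lax $\lambda:F\to G$. For an object $A$, consider pairs $(g:B\to A,\,y)$ with $g$ a morphism of $\mathcal{C}$ and $y\in FB$, preordered by: $(g_1:B_1\to A,y_1)\preceq(g_2:B_2\to A,y_2)$ iff there is a morphism $s:B_2\to B_1$ with $g_1s\le g_2$ and $y_1\le Fs(y_2)$ (the induced poset is denoted $F^\#A$). For $x\in FA$, $l'_A\downarrow x$ is the set of such pairs (up to equivalence) with $Fg(y)\le x$, and $(l'_A\downarrow x)_{=}$ is the subset of those with $Fg(y)=x$. A subset $S$ of a preorder $P$ is cofinal if for every $p\in P$ there is $s\in S$ with $p\le s$. A $\kappa$-wide pullback is a limit of a diagram consisting of a family of morphisms $(g_i:C_i\to A)_{i\in I}$ with common codomain and $|I|<\kappa$. A $\kappa$-directed join is the join of a subset in which every subfamily of cardinality $<\kappa$ has an upper bound in the subset. *)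

(* Defs.v *)
From HB Require Import structures.
From mathcomp Require Import all_boot all_order.
From mathcomp Require Import boolp classical_sets functions cardinality.

Set Implicit Arguments.
Unset Strict Implicit.
Unset Printing Implicit Defensive.

Import Order.TTheory.
Local Open Scope classical_set_scope.
Local Open Scope order_scope.

(* The objects form a type whose universe is large enough for [Pos] below to be
   an instance; every small category is one a fortiori. *)
Record poscat (d : Order.disp_t) := PosCat {
  ob :> Type;
  hom : ob -> ob -> porderType d;
  hid : forall A, hom A A;
  hcomp : forall A B C, hom B C -> hom A B -> hom A C;
  hcompA : forall A B C D (h : hom C D) (g : hom B C) (f : hom A B),
    hcomp h (hcomp g f) = hcomp (hcomp h g) f;
  hcomp1l : forall A B (f : hom A B), hcomp (hid B) f = f;
  hcomp1r : forall A B (f : hom A B), hcomp f (hid A) = f;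
  hcomp_mono : forall A B C (g g' : hom B C) (f f' : hom A B),
    g <= g' -> f <= f' -> hcomp g f <= hcomp g' f' }.

Arguments hid {d p} A.

Record posfunctor d d' (C : poscat d) (D : poscat d') := PosFunctor {
  fob : C -> D;
  fmap : forall A B, hom A B -> hom (fob A) (fob B);
  fmap_mono : forall A B (f f' : hom A B), f <= f' -> fmap f <= fmap f';
  fmap_id : forall A, fmap (hid A) = hid (fob A);
  fmap_comp : forall A B E (g : hom B E) (f : hom A B),
    fmap (hcomp g f) = hcomp (fmap g) (fmap f) }.

Section OMorphismPOrder.
Variables (d d' : Order.disp_t) (X : porderType d) (Y : porderType d').

HB.instance Definition _ := gen_eqMixin {omorphism X -> Y}.
HB.instance Definition _ := gen_choiceMixin {omorphism X -> Y}.

Lemma omorphism_ext (f g : {omorphism X -> Y}) : f =1 g -> f = g.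
Proof.
case: f g => [f [[fm]]] [g [[gm]]] /= fg.
have {}fg : f = g by exact: funext.
by rewrite -{}fg in gm *; rewrite (Prop_irrelevance fm gm).
Qed.

Definition omorphism_leb (f g : {omorphism X -> Y}) : bool :=
  `[< forall x, f x <= g x >].

Lemma omorphism_lebP (f g : {omorphism X -> Y}) :
  reflect (forall x, f x <= g x) (omorphism_leb f g).
Proof. exact: asboolP. Qed.

Lemma omorphism_leb_refl : reflexive omorphism_leb.
Proof. by move=> f; apply/omorphism_lebP => x. Qed.

Lemma omorphism_leb_anti : antisymmetric omorphism_leb.
Proof.
move=> f g /andP[/omorphism_lebP fg /omorphism_lebP gf].
by apply: omorphism_ext => x; apply/eqP; rewrite eq_le fg gf.
Qed.

Lemma omorphism_leb_trans : transitive omorphism_leb.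
Proof.
move=> g f h /omorphism_lebP fg /omorphism_lebP gh.
by apply/omorphism_lebP => x; apply: le_trans (fg x) (gh x).
Qed.

HB.instance Definition _ := Order.Le_isPOrder.Build d' {omorphism X -> Y}
  omorphism_leb_refl omorphism_leb_anti omorphism_leb_trans.

Lemma le_omorphismP (f g : {omorphism X -> Y}) :
  reflect (forall x, f x <= g x) (f <= g).
Proof. exact: omorphism_lebP. Qed.

End OMorphismPOrder.

Section Pos.
Variable d : Order.disp_t.

Definition pos_hom (X Y : porderType d) : porderType d := {omorphism X -> Y}.
Definition pos_id (X : porderType d) : pos_hom X X :=
  (idfun : {omorphism X -> X}).
Definition pos_comp (X Y Z : porderType d)
    (g : {omorphism Y -> Z}) (f : {omorphism X -> Y}) : pos_hom X Z :=
  (g \o f : {omorphism X -> Z}).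

Lemma pos_compA X Y Z W
    (h : pos_hom Z W) (g : pos_hom Y Z) (f : pos_hom X Y) :
  pos_comp h (pos_comp g f) = pos_comp (pos_comp h g) f.
Proof. exact: omorphism_ext. Qed.

Lemma pos_comp1l X Y (f : pos_hom X Y) : pos_comp (pos_id Y) f = f.
Proof. exact: omorphism_ext. Qed.

Lemma pos_comp1r X Y (f : pos_hom X Y) : pos_comp f (pos_id X) = f.
Proof. exact: omorphism_ext. Qed.

Lemma pos_comp_mono X Y Z (g g' : pos_hom Y Z) (f f' : pos_hom X Y) :
  g <= g' -> f <= f' -> pos_comp g f <= pos_comp g' f'.
Proof.
move=> /le_omorphismP gg' /le_omorphismP ff'; apply/le_omorphismP => x /=.
by apply: le_trans (gg' _); apply: omorph_le; apply: ff'.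
Qed.

Definition Pos : poscat d :=
  PosCat pos_compA pos_comp1l pos_comp1r pos_comp_mono.

End Pos.

(* [F A] is the poset FA and [act F f] the order-preserving map Ff, for an
   enriched functor F into Pos. *)
Definition posval d d' (C : poscat d) (F : posfunctor C (Pos d')) (A : C) :
  porderType d' := fob F A.
Coercion posval : posfunctor >-> Funclass.

Definition act d d' (C : poscat d) (F : posfunctor C (Pos d')) (A B : C)
  (f : hom A B) : {omorphism F A -> F B} := fmap F f.

(* A cardinal is represented by a type having that cardinality. *)
Definition card_lt T U (A : set T) (B : set U) : Prop :=
  (A #<= B)%card /\ ~ (B #<= A)%card.

(* Infinite, and not the union of fewer than [K] subsets, each of cardinality
   less than [K]. *)
Definition regular_cardinal (K : Type) : Prop :=
  infinite_set [set: K] /\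
  forall (I : set K) (J : K -> set K), card_lt I [set: K] ->
    (forall i, I i -> card_lt (J i) [set: K]) ->
    card_lt (\bigcup_(i in I) J i) [set: K].

(* [supremums S x] says that x is the join of S. *)
Definition complete_poset d (T : porderType d) : Prop :=
  forall S : set T, supremums S !=set0.

Definition directed (K : Type) d (T : porderType d) (S : set T) : Prop :=
  forall U : set T, U `<=` S -> card_lt U [set: K] ->
    exists2 b, S b & ubound U b.

Definition preserves_directed_joins (K : Type) d d'
    (T : porderType d) (T' : porderType d') (h : T -> T') : Prop :=
  forall (S : set T) (x : T), directed K S -> supremums S x ->
    supremums (h @` S) (h x).

(* Limits are taken with respect to the underlying ordinary category.
   Conical enriched limits are in particular such limits, and a functor that
   preserves enriched wide pullbacks, where these exist, preserves the ordinary
   ones, since the latter are isomorphic to the enriched ones. *)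
Section WidePullback.
Variables (d : Order.disp_t) (C : poscat d) (I : Type) (A : C) (D : I -> C).
Variable g : forall i, hom (D i) A.

(* The leg [p] at the common codomain A is needed for empty families. *)
Definition is_cone (P : C) (p : hom P A) (q : forall i, hom P (D i)) : Prop :=
  forall i, hcomp (g i) (q i) = p.

Definition is_wide_pullback (P : C) (p : hom P A) (q : forall i, hom P (D i)) :
    Prop :=
  is_cone p q /\
  forall (X : C) (p' : hom X A) (q' : forall i, hom X (D i)), is_cone p' q' ->
    exists! h : hom X P, hcomp p h = p' /\ forall i, hcomp (q i) h = q' i.

End WidePullback.

Definition has_wide_pullbacks (K : Type) d (C : poscat d) : Prop :=
  forall (I : Type) (A : C) (D : I -> C) (g : forall i, hom (D i) A),
    card_lt [set: I] [set: K] ->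
    exists (P : C) (p : hom P A) (q : forall i, hom P (D i)),
      is_wide_pullback g p q.

Definition preserves_wide_pullbacks (K : Type) d d'
    (C : poscat d) (D : poscat d') (F : posfunctor C D) : Prop :=
  forall (I : Type) (A : C) (E : I -> C) (g : forall i, hom (E i) A)
    (P : C) (p : hom P A) (q : forall i, hom P (E i)),
    card_lt [set: I] [set: K] -> is_wide_pullback g p q ->
    is_wide_pullback (fun i => fmap F (g i)) (fmap F p)
      (fun i => fmap F (q i)).

Section Transformations.
Variables (d dF dG : Order.disp_t) (C : poscat d).
Variables (F : posfunctor C (Pos dF)) (G : posfunctor C (Pos dG)).

Definition transf : Type := forall A : C, {omorphism F A -> G A}.

Definition lax (t : transf) : Prop :=
  forall (A B : C) (f : hom A B) (x : F A), t B (act F f x) <= act G f (t A x).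

Definition colax (t : transf) : Prop :=
  forall (A B : C) (f : hom A B) (x : F A), act G f (t A x) <= t B (act F f x).

Definition strict (t : transf) : Prop :=
  forall (A B : C) (f : hom A B) (x : F A), t B (act F f x) = act G f (t A x).

Definition transf_le (t u : transf) : Prop :=
  forall (A : C) (x : F A), t A x <= u A x.

Definition is_colaxification (l s : transf) : Prop :=
  [/\ colax s, transf_le l s &
      forall s' : transf, colax s' -> transf_le l s' -> transf_le s s'].

Lemma colaxification_exists (l : transf) :
  (forall A, complete_poset (G A)) -> exists s, is_colaxification l s.
Proof.
move=> Gc.
pose L A x : set (G A) := [set z | forall s' : transf,
  colax s' -> transf_le l s' -> z <= s' A x].
have E A : {m : F A -> G A & forall x, supremums (L A x) (m x)}.
  by apply: (choice (P := fun x z => supremums (L A x) z)) => x; apply: Gc.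
pose m A := projT1 (E A).
have mP A x : supremums (L A x) (m A x) := projT2 (E A) x.
have m_le s' A x : colax s' -> transf_le l s' -> m A x <= s' A x.
  by move=> s'c ls'; have [_] := mP A x; apply => z; apply.
have le_m A x z : L A x z -> z <= m A x by have [+ _] := mP A x; apply.
have m_homo A : {homo m A : x y / x <= y}.
  move=> x y xy; apply: le_m => s' s'c ls'.
  by apply: le_trans (m_le s' A x s'c ls') _; apply: omorph_le.
pose s : transf := fun A =>
  HB.pack (m A) (Order.isOrderMorphism.Build _ _ _ _ (m A) (@m_homo A)).
exists s; split => [A B f x|A x|s' s'c ls' A x] /=.
- apply: le_m => s' s'c ls'; apply: le_trans (s'c A B f x).
  by apply: omorph_le; apply: m_le.
- by apply: le_m => s' _; apply.
- exact: m_le.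
Qed.

Definition colaxification (Gc : forall A, complete_poset (G A)) (l : transf) :
  transf := projT1 (cid (colaxification_exists l Gc)).

Lemma colaxificationP (Gc : forall A, complete_poset (G A)) (l : transf) :
  is_colaxification l (colaxification Gc l).
Proof. exact: projT2 (cid (colaxification_exists l Gc)). Qed.

(* The strictness condition for the triple (F, G, empty set). *)
Definition strictness_condition (Gc : forall A, complete_poset (G A)) : Prop :=
  forall l : transf, lax l -> strict (colaxification Gc l).

End Transformations.

Arguments colaxification {d dF dG C F G} Gc l.
Arguments strictness_condition {d dF dG C} F G Gc.

Section Sharp.
Variables (d dF : Order.disp_t) (C : poscat d) (F : posfunctor C (Pos dF)).

(* The preorder whose poset reflection is F^# A. Cofinality is not affected by
   passing to the reflection, as [lprime] is monotone. *)
Record sharp (A : C) := Sharp {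
  sharp_dom : C;
  sharp_arr : hom sharp_dom A;
  sharp_elt : F sharp_dom }.

Definition sharp_le A (a b : sharp A) : Prop :=
  exists s : hom (sharp_dom b) (sharp_dom a),
    hcomp (sharp_arr a) s <= sharp_arr b /\
    sharp_elt a <= act F s (sharp_elt b).

Definition lprime A (a : sharp A) : F A := act F (sharp_arr a) (sharp_elt a).

Definition lprime_down A (x : F A) (a : sharp A) : Prop := lprime a <= x.

Definition lprime_down_eq A (x : F A) (a : sharp A) : Prop := lprime a = x.

End Sharp.

(* Predicates rather than [set T], whose universe is too small for [sharp]. *)
Definition cofinal (T : Type) (R : T -> T -> Prop) (P S : T -> Prop) : Prop :=
  (forall s, S s -> P s) /\ forall p, P p -> exists2 s, S s & R p s.

(* Main.v *)
(** By (F1) the proposed join [m_A x] may be taken over the pairs [(g, y)] with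
    [Fg y = x] only, and by (F2) these are [K]-directed: a family of them lifts
    to a point of [F P], for the wide pullback P of the arrows. Hence (G1)
    applies to this join and makes [m] colax; it is then the colaxification.
    For [f : A -> B], strictness follows from pulling back each [g] with
    [Fg y = Ff x] along [f]. *)
Require Import Defs.
From HB Require Import structures.
From mathcomp Require Import all_boot all_order.
From mathcomp Require Import boolp classical_sets functions cardinality.

Local Open Scope classical_set_scope.
Local Open Scope order_scope.
Import Order.TTheory.

Set Implicit Arguments.
Unset Strict Implicit.
Unset Printing Implicit Defensive.

Lemma supremums_le d (T : porderType d) (S S' : set T) (x x' : T) :
  (forall s, S s -> exists2 s', S' s' & s <= s') ->
  supremums S x -> supremums S' x' -> x <= x'.
Proof.
move=> SS' [_ xlub] [x'ub _]; apply: xlub => s /SS'[s' /x'ub s'x' ss'].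
exact: le_trans s'x'.
Qed.

Lemma supremums_cofinal d (T : porderType d) (S S' : set T) (x : T) :
  S' `<=` S -> (forall s, S s -> exists2 s', S' s' & s <= s') ->
  supremums S x -> supremums S' x.
Proof.
move=> S'S SS' [xub xlub]; split=> [s /S'S/xub //|y yub].
by apply: xlub => s /SS'[s' /yub s'y ss']; apply: le_trans s'y.
Qed.

(** Makes the pullback of two arrows, indexed by [bool], a [K]-wide one. *)
Lemma card_lt_bool K : infinite_set [set: K] -> card_lt [set: bool] [set: K].
Proof.
move=> Kinf; split; last by move=> /card_le_finite fin; apply: Kinf; apply: fin.
by apply: card_le_trans ((infiniteP _).1 Kinf); apply: finite_set_countable.
Qed.

Section Functor.
Variables (d dF : Order.disp_t) (C : poscat d) (F : posfunctor C (Pos dF)).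

Lemma act_id A x : act F (hid A) x = x.
Proof. by rewrite /act fmap_id. Qed.

Lemma act_comp A B E (g : hom B E) (f : hom A B) x :
  act F (hcomp g f) x = act F g (act F f x).
Proof. by rewrite /act fmap_comp. Qed.

Lemma act_le A B (f f' : hom A B) x : f <= f' -> act F f x <= act F f' x.
Proof. by move=> /(fmap_mono F)/le_omorphismP; apply. Qed.

(* Points are represented by constant maps out of [F A]. *)
Lemma wide_pullback_point I (A : C) (D : I -> C) (g : forall i, hom (D i) A)
    (P : C) (p : hom P A) (q : forall i, hom P (D i))
    (x : F A) (y : forall i, F (D i)) :
  is_wide_pullback (fun i => fmap F (g i)) (fmap F p) (fun i => fmap F (q i)) ->
  (forall i, act F (g i) (y i) = x) ->
  exists2 z : F P, act F p z = x & forall i, act F (q i) z = y i.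
Proof.
pose const (B : C) (b : F B) : {omorphism F A -> F B} :=
  HB.pack (fun _ : F A => b) (Order.isOrderMorphism.Build _ _ _ _
    (fun _ : F A => b) (fun _ _ _ => lexx b)).
move=> [_ univ] gy.
have [|h [[hp hq] _]] := univ (F A) (const A x) (fun i => const (D i) (y i)).
  by move=> i; apply: omorphism_ext => a /=; apply: gy.
(* [F A] stands in for the one-point poset: [h] may be evaluated at any point, and [x] is one. *)
exists ((h : {omorphism F A -> F P}) x) => [|i].
  by have := congr1 (fun k : {omorphism F A -> F A} => k x) hp.
by have := congr1 (fun k : {omorphism F A -> F (D i)} => k x) (hq i).
Qed.

End Functor.

Section Colaxification.
Variables (d dF dG : Order.disp_t) (C : poscat d).
Variables (F : posfunctor C (Pos dF)) (G : posfunctor C (Pos dG)).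
Hypothesis Gcomplete : forall A : C, complete_poset (G A).
Variable K : Type.
Hypothesis Kinf : infinite_set [set: K].
Hypothesis G1 :
  forall (A B : C) (f : hom A B), preserves_directed_joins K (act G f).
Hypothesis F1 : forall (A : C) (x : F A),
  cofinal (@sharp_le _ _ _ F A) (lprime_down x) (lprime_down_eq x).
Hypothesis Cpb : has_wide_pullbacks K C.
Hypothesis Fpb : preserves_wide_pullbacks K F.
Variable l : transf F G.
Hypothesis l_lax : lax l.

Lemma lift_family I (A : C) (D : I -> C) (g : forall i, hom (D i) A)
    (x : F A) (y : forall i, F (D i)) :
  card_lt [set: I] [set: K] -> (forall i, act F (g i) (y i) = x) ->
  exists (P : C) (p : hom P A) (q : forall i, hom P (D i)) (z : F P),
    [/\ act F p z = x, forall i, hcomp (g i) (q i) = p &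
        forall i, act F (q i) z = y i].
Proof.
move=> IK gy; have [P [p [q pb]]] := Cpb g IK.
have [z pz qz] := wide_pullback_point (Fpb IK pb) gy.
by exists P, p, q, z; split=> //; case: pb.
Qed.

Definition value A (a : sharp F A) : G A :=
  act G (sharp_arr a) (l (sharp_dom a) (sharp_elt a)).

(** Spelled out without [sharp], to agree literally with the set in the theorem. *)
Definition values A (x : F A) : set (G A) :=
  [set z | exists (B : C) (g : hom B A) (y : F B),
    act F g y <= x /\ z = act G g (l B y)].

Definition fiber_values A (x : F A) : set (G A) :=
  [set z | exists2 a, lprime_down_eq x a & value a = z].

(** Laxity at [s] gives [Gg (l y) <= Gg (l (Fs y')) <= Gg (Gs (l y')) <= Gg' (l y')], for
    [a = (g, y)] and [b = (g', y')]. *)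
Lemma value_le A (a b : sharp F A) : sharp_le a b -> value a <= value b.
Proof.
move=> [s [gs ys]]; rewrite /value.
apply: (le_trans _ (act_le _ gs)); rewrite act_comp.
by apply: omorph_le; apply: (le_trans _ (l_lax _ _)); apply: omorph_le.
Qed.

Lemma fiber_values_sub A (x : F A) : fiber_values x `<=` values x.
Proof.
move=> z [[B g y] gyx <-]; exists B, g, y; split=> //.
by rewrite -gyx.
Qed.

Lemma fiber_values_cofinal A (x : F A) z :
  values x z -> exists2 z', fiber_values x z' & z <= z'.
Proof.
move=> [B [g [y [gyx ->]]]]; have [_ cof] := F1 x.
have [b bx ab] := cof (Sharp g y) gyx.
by exists (value b); [exists b | apply: (value_le ab)].
Qed.

Lemma fiber_values_directed A (x : F A) : directed K (fiber_values x).
Proof.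
move=> U Ux UK.
(* One pair is chosen for each element of [U], so that the family of arrows is indexed by [U] itself
   and is small enough for (F2). *)
have /choice[a aP] (u : U) : exists a, lprime_down_eq x a /\ value a = val u.
  by have [|a] := Ux (val u); [exact: set_valP | exists a].
have IK : card_lt [set: U] [set: K].
  by split; have [lt nlt] := UK; rewrite ?(card_le_eql (card_setT U))
    ?(card_le_eqr (card_setT U)).
have [P [p [q [z [pz gq qz]]]]] := lift_family IK (fun u => (aP u).1).
exists (value (Sharp p z)); first by exists (Sharp p z).
move=> u Uu; pose v : U := exist _ u (mem_set Uu).
rewrite -[u]/(val v) -(aP v).2.
(* The projection [q v] witnesses [sharp_le], both of its inequalities being equalities here. *)
by apply: value_le; exists (q v); rewrite gq qz.
Qed.

(** The join is monotone in [x] because [values x] grows with [x]; this is not apparent for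
    [fiber_values x]. *)
Lemma values_lub : exists m : transf F G,
  forall A (x : F A), supremums (values x) (m A x).
Proof.
have E A : {m : F A -> G A & forall x, supremums (values x) (m x)}.
  by apply: (choice (P := fun x z => supremums (values x) z)) => x;
    apply: Gcomplete.
pose m A := projT1 (E A).
have m_homo A : {homo m A : x y / x <= y}.
  move=> x y xy; apply: supremums_le (projT2 (E A) x) (projT2 (E A) y).
  move=> _ [B [g [b [gbx ->]]]]; exists (act G g (l B b)) => //.
  by exists B, g, b; split=> //; apply: le_trans xy.
pose t : transf F G := fun A =>
  HB.pack (m A) (Order.isOrderMorphism.Build _ _ _ _ (m A) (@m_homo A)).
by exists t => A x; apply: (projT2 (E A)).
Qed.

Section Values.
Variable m : transf F G.
Hypothesis mP : forall A (x : F A), supremums (values x) (m A x).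

Lemma fiber_values_lub A (x : F A) : supremums (fiber_values x) (m A x).
Proof.
apply: supremums_cofinal (mP x); first exact: fiber_values_sub.
exact: fiber_values_cofinal.
Qed.

(** [Gf] commutes with the directed join over [fiber_values x], and sends the term of [(g, y)] to
    that of [(fg, y)], which lies in [values (Ff x)]. *)
Lemma values_lub_colax : colax m.
Proof.
move=> A B f x.
apply: supremums_le (G1 _ (@fiber_values_directed A x) (fiber_values_lub x))
  (mP _).
move=> _ [_ [[D g y] gyx <-] <-]; exists (act G f (act G g (l D y))) => //.
by exists D, (hcomp f g), y; rewrite !act_comp -gyx.
Qed.

Lemma values_lub_strict : strict m.
Proof.
move=> A B f x; apply/eqP; rewrite eq_le values_lub_colax andbT.
have [_] := fiber_values_lub (act F f x); apply=> _ [[D g y] gy <-].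
(* The pullback of [g] (index [true]) and [f] (index [false]); the points [y] and [x] both lie over
   [Ff x], hence lift to one [z]. *)
pose E b := if b then D else A.
pose k : forall b, hom (E b) B := fun b =>
  if b as b return hom (E b) B then g else f.
pose w : forall b, F (E b) := fun b =>
  if b as b return F (E b) then y else x.
have [|P [p [q [z [pz kq qz]]]]] :=
  @lift_family bool B E k (act F f x) w (card_lt_bool Kinf).
  by case=> //=; apply: gy.
have /= gy' := qz true; have /= fx := qz false.
rewrite /value /= -gy'.
(* After laxity at [q true], the pullback square turns the bound into [Gf] applied to the term of
   [(q false, z)], which lies in [values x]. *)
apply: le_trans (omorph_le _ (l_lax _ _)) _.
rewrite -act_comp (kq true) -(kq false) act_comp; apply: omorph_le.
have [mub _] := mP x; apply: mub.
by exists P, (q false), z; rewrite fx.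
Qed.

(** The pair [(id, x)] puts [m] above [l]. If [s] is colax and above [l], then
    [Gg (l y) <= Gg (s y) <= s (Fg y) <= s x] bounds every term. *)
Lemma values_lub_is_colaxification : is_colaxification l m.
Proof.
split; first exact: values_lub_colax.
  move=> A x; have [mub _] := mP x; apply: mub.
  by exists A, (hid A), x; rewrite !act_id.
move=> s s_colax ls A x; have [_] := mP x; apply=> _ [B [g [y [gyx ->]]]].
apply: le_trans (omorph_le _ (ls _ _)) _.
by apply: le_trans (s_colax _ _ _ _) _; apply: omorph_le.
Qed.

End Values.

Lemma colaxification_values :
  strict (colaxification Gcomplete l) /\
  forall A (x : F A), supremums (values x) (colaxification Gcomplete l A x).
Proof.
have [m mP] := values_lub.
have [m_colax lm m_min] := values_lub_is_colaxification mP.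
have [c_colax lc c_min] := colaxificationP Gcomplete l.
(* Least colax transformations above [l] agree pointwise, so the properties of [m] transfer. *)
have cm A x : colaxification Gcomplete l A x = m A x.
  by apply/eqP; rewrite eq_le c_min ?m_min.
split=> [A B f x|A x]; rewrite !cm; last exact: mP.
exact: values_lub_strict.
Qed.

End Colaxification.

Unset Implicit Arguments.

Theorem theorem4p5 (d dF dG : Order.disp_t) (C : poscat d)
    (F : posfunctor C (Pos dF)) (G : posfunctor C (Pos dG))
    (Gcomplete : forall A : C, complete_poset (G A))
    (K : Type) (Kreg : regular_cardinal K)
    (G1 : forall (A B : C) (f : hom A B), preserves_directed_joins K (act G f))
    (F1 : forall (A : C) (x : F A),
      cofinal (@sharp_le _ _ _ F A) (lprime_down x) (lprime_down_eq x))
    (F2 : has_wide_pullbacks K C /\ preserves_wide_pullbacks K F) :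
  strictness_condition F G Gcomplete /\
  forall l : transf F G, lax l -> forall (A : C) (x : F A),
    supremums
      [set z | exists (B : C) (g : hom B A) (y : F B),
        act F g y <= x /\ z = act G g (l B y)]
      (colaxification Gcomplete l A x).
Proof.
have [Kinf _] := Kreg; have [Cpb Fpb] := F2.
by split=> l /(colaxification_values Gcomplete Kinf G1 F1 Cpb Fpb)[].
Qed.
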